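(* Let $X$ be an $n\times n$ real symmetric random matrix with $X_{ij}=b_{ij}\xi_{ij}$ for $i\ne j$ and $X_{ii}=\sqrt{2}\,b_{ii}\xi_{ii}$, where $b_{ij}=b_{ji}\ge 0$ are arbitrary nonnegative scalars, and $\xi_{ij}=\xi_{ji}$ are symmetrically distributed real random variables that are independent for $i\ge j$ and satisfy $\mathbf{E}[\xi_{ij}^{2p}]\le\mathbf{E}[g^{2p}]$ for all $i,j$ and all $p\in\mathbb{N}$, where $g\sim N(0,1)$. Let $$\sigma^2:=\max_{i\le n}\sum_{j\le n} b_{ij}^2,\qquad \sigma_*^2:=\max_{i,j\le n} b_{ij}^2,$$ and assume that $\sigma_*^2=1$ and $\sigma^2\le d\in\mathbb{N}$. Then $$\mathbf{E}[\mathrm{tr}\,X^{2p}]\le\mathbf{E}[\mathrm{tr}\,Y^{2p}]$$ for all $p\in\mathbb{N}$, where $Y$ is the $d\times d$ real symmetric matrix whose entries $Y_{ij}=Y_{ji}$ are independent for $i\ge j$ with $Y_{ij}\sim N(0,1)$ for $i>j$ and $Y_{ii}\sim N(0,2)$.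
   Context: For a $k\times k$ matrix $M$, $\mathrm{tr}\,M:=\frac1k\sum_{i=1}^k M_{ii}$ denotes the normalized trace. $N(0,s^2)$ is the real centered Gaussian law with variance $s^2$ (so $N(0,2)$ has variance $2$). ''Symmetrically distributed'' means that $\xi_{ij}$ and $-\xi_{ij}$ have the same law. *)

(* Defs.v *)
From mathcomp Require Import all_boot all_order all_algebra.
From mathcomp Require Import all_classical all_reals all_analysis.

Set Implicit Arguments.
Unset Strict Implicit.
Unset Printing Implicit Defensive.

Import Order.TTheory GRing.Theory Num.Theory.
Import numFieldNormedType.Exports.

Local Open Scope classical_set_scope.
Local Open Scope ring_scope.

Definition ntrace (R : realType) (k : nat) (M : 'M[R]_k) : R :=
  k%:R^-1 * \tr M.

(* The default value 0 of the two maxima is harmless: all terms are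
   nonnegative, and sigma_star2 b = 1 excludes n = 0. *)
Definition sigma2 (R : realType) (n : nat) (b : 'I_n -> 'I_n -> R) : R :=
  \big[Num.max/0]_(i < n) \sum_(j < n) b i j ^+ 2.

Definition sigma_star2 (R : realType) (n : nat) (b : 'I_n -> 'I_n -> R) : R :=
  \big[Num.max/0]_(i < n) \big[Num.max/0]_(j < n) b i j ^+ 2.

(* Laws are compared on Borel sets only, since the library's measures are
   functions on all sets. *)
Definition has_law (R : realType) (disp : measure_display)
    (T : measurableType disp) (P : probability T R)
    (X : {RV P >-> R}) (mu : set R -> \bar R) : Prop :=
  forall A : set R, measurable A -> distribution P X A = mu A.

Definition symmetrically_distributed (R : realType) (disp : measure_display)
    (T : measurableType disp) (P : probability T R) (X : {RV P >-> R}) : Prop :=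
  has_law X (pushforward P (\- X)).

(* The second parameter of normal_prob is the standard deviation. *)
Definition gaussian_law (R : realType) (v : R) :
    probability (measurableTypeR R) R :=
  normal_prob (0 : R) (Num.sqrt v).

Definition mutually_independent (R : realType) (disp : measure_display)
    (T : measurableType disp) (P : probability T R) (I : finType)
    (D : {set I}) (X : I -> {RV P >-> R}) : Prop :=
  forall (J : {set I}) (B : I -> set R), J \subset D ->
    (forall i, i \in J -> measurable (B i)) ->
    P (\bigcap_(i in [set` J]) (X i @^-1` B i)) =
    (\prod_(i in J) P (X i @^-1` B i))%E.

Definition independent_lower (R : realType) (disp : measure_display)
    (T : measurableType disp) (P : probability T R) (n : nat)
    (X : 'I_n -> 'I_n -> {RV P >-> R}) : Prop :=
  mutually_independent [set ij : 'I_n * 'I_n | (ij.2 <= ij.1)%N]%SET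
    (fun ij => X ij.1 ij.2).

Definition random_mx (R : realType) (disp : measure_display)
    (T : measurableType disp) (P : probability T R) (n : nat)
    (X : 'I_n -> 'I_n -> {RV P >-> R}) (w : T) : 'M[R]_n :=
  \matrix_(i, j) X i j w.

(* Main.v *)
Require Import Defs.
From mathcomp Require Import all_boot all_order all_algebra.
From mathcomp Require Import all_classical all_reals all_analysis.
From mathcomp Require Import measurable_realfun ring lra zify.

Set Implicit Arguments.
Unset Strict Implicit.
Unset Printing Implicit Defensive.

Import Order.TTheory GRing.Theory Num.Theory.
Import numFieldNormedType.Exports.

Local Open Scope classical_set_scope.
Local Open Scope ring_scope.

(** Everything reduces to a count of vertices in glued polygons.

    Expand the trace of a power as a sum over cyclic words.  Independence turns
    the expectation of a word into a product, over the unordered pairs of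
    indices that it traverses, of moments of single entries.  Odd moments
    vanish by symmetry and even ones are at most Gaussian, so the expectation
    of a word is at most its value for Gaussian entries; for Y it is equal to
    it.

    For Gaussian entries, Wick's formula writes a word as a sum over perfect
    matchings of its letters ([hafnian_diagonal]).  Since the diagonal has twice
    the variance, the covariance of the entries (a, a') and (e, e') is
    b(a, a') b(e, e') times [a = e][a' = e'] + [a = e'][a' = e] in all cases, so
    that a matching comes with a choice, for each matched pair, of gluing two
    sides of the polygon with or without a twist.  Both traces then become sums
    over the same set of twisted matchings, which can be compared one by one.

    Fix a twisted matching.  It identifies the vertices of the polygon into V
    classes.  For Y there are d ^ V admissible words, each of weight 1.  For X,
    admissible words are weighted by the product of b ^ 2 over the glued sides.
    Read the polygon from its starting point: the sides that lead to a class for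
    the first time form a spanning tree, and two sides glued together are never
    both in the tree.  Bounding by 1 the weights off the tree, and then removing
    the leaves one at a time, each at the cost of a row sum of b ^ 2, which is
    at most d, bounds the total weight by n * d ^ (V - 1).  Dividing by n,
    respectively by d, gives the comparison; this is [hafnian_sum_le].  *)

(** * Transfer of an integral against a weight *)

Section Weighted.
Context d1 d2 (S : measurableType d1) (T : measurableType d2) (R : realType).
Variables (mu : {measure set S -> \bar R}) (nu : {measure set T -> \bar R}).
Variables (phi : S -> T) (w : S -> R) (c : R).
Hypotheses (mphi : measurable_fun setT phi) (mw : measurable_fun setT w).
Hypotheses (w_ge0 : forall x, 0 <= w x) (c_ge0 : 0 <= c).
Hypothesis mu_nu : forall A, measurable A ->
  (\int[mu]_x (\1_A (phi x) * w x)%:E = c%:E * nu A)%E.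

Import HBNNSimple.

(** The passage from indicators to nonnegative functions, by simple functions and
    monotone convergence, in a form that serves three purposes: independence
    (phi is a random variable, w a function of the others), densities (phi is
    the identity) and changes of law (w is constant).  *)
Lemma ge0_integral_weighted (h : T -> R) : measurable_fun setT h ->
  (forall y, 0 <= h y) ->
  (\int[mu]_x (h (phi x) * w x)%:E = c%:E * \int[nu]_y (h y)%:E)%E.
Proof.
move=> mh h0.
pose Eh : T -> \bar R := EFin \o h.
have mEh : measurable_fun setT Eh by exact/measurable_EFinP.
pose f_ := nnsfun_approx measurableT mEh.
have cf y : (f_ n y)%:E @[n --> \oo] --> (h y)%:E.
  by apply: (@cvg_nnsfun_approx _ _ _ _ measurableT _ mEh) => // ? _; rewrite lee_fin.
have fphi n : measurable_fun setT (f_ n \o phi).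
  exact: measurableT_comp.
transitivity (limn (fun n => \int[mu]_x (f_ n (phi x) * w x)%:E)%E).
  rewrite -monotone_convergence//.
  - apply: eq_integral => x _; apply/esym/cvg_lim => //.
    under eq_fun do rewrite EFinM.
    by rewrite EFinM; apply: cvgeZr.
  - move=> n; apply/measurable_EFinP; apply: measurable_funM => //.
    exact: fphi.
  - by move=> n x _; rewrite lee_fin mulr_ge0.
  - move=> x _ m n mn; rewrite lee_fin ler_wpM2r//.
    exact/lefP/nd_nnsfun_approx.
transitivity (limn (fun n => c%:E * \int[nu]_y (f_ n y)%:E)%E); last first.
  apply/cvg_lim => //; apply: cvgeZl => //.
  have -> : (\int[nu]_y (h y)%:E = \int[nu]_y limn (fun n => (f_ n y)%:E))%E.
    by apply: eq_integral => y _; apply/esym/cvg_lim.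
  apply: cvg_monotone_convergence => //.
  - by move=> n; exact/measurable_EFinP.
  - by move=> n y _; rewrite lee_fin.
  - by move=> y _ m n mn; rewrite lee_fin; exact/lefP/nd_nnsfun_approx.
congr (limn _); apply/funext => n.
rewrite integralT_nnsfun sintegralE.
have mpre r : measurable (f_ n @^-1` [set r]) by [].
transitivity (\sum_(k \in range (f_ n))
    \int[mu]_x (k%:E * (\1_(f_ n @^-1` [set k]) (phi x) * w x)%:E))%E.
  rewrite -ge0_integral_fsum//=.
  - apply: eq_integral => x _; rewrite [X in (X * w x)%:E](fimfunE (f_ n)).
    rewrite fsbig_finite//= big_distrl/= -sumEFin [RHS]fsbig_finite//=.
    by apply: eq_bigr => k _; rewrite -EFinM mulrA.
  - move=> k; apply: emeasurable_funM => //; apply/measurable_EFinP.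
    apply: measurable_funM => //.
    by apply: (@measurableT_comp _ _ _ _ _ _ (\1_(f_ n @^-1` [set k]) : T -> R)).
  - move=> k x _; rewrite -EFinM lee_fin mulrA mulr_ge0//.
    by have := nnfun_muleindic_ge0 (f_ n) k (phi x); rewrite lee_fin.
rewrite [RHS]ge0_mule_fsumr; last first.
  by move=> k; exact: nnsfun_mulemu_ge0.
apply: eq_fsbigr => k /set_mem[y _ <-].
rewrite ge0_integralZl//.
- by rewrite mu_nu// muleCA.
- apply/measurable_EFinP; apply: measurable_funM => //.
  by apply: (@measurableT_comp _ _ _ _ _ _ (\1_(f_ n @^-1` [set f_ n y]) : T -> R)).
- by move=> x _; rewrite lee_fin mulr_ge0.
- by rewrite lee_fin.
Qed.

End Weighted.

(** * Products of functions of independent variables *)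

Section IndependentProduct.
Context (R : realType) (disp : measure_display) (T : measurableType disp).
Context (P : probability T R) (I : finType) (D : {set I}) (X : I -> {RV P >-> R}).
Hypothesis indep : mutually_independent D X.

Definition with_value {A : Type} (k : I) (a : A) (h : I -> A) (i : I) : A :=
  if i == k then a else h i.

Lemma with_value_at {A : Type} k (a : A) h : with_value k a h k = a.
Proof. by rewrite /with_value eqxx. Qed.

Lemma with_value_neq {A : Type} k (a : A) h i :
  i != k -> with_value k a h i = h i.
Proof. by rewrite /with_value => /negbTE ->. Qed.

Lemma prod_with_value (S : comNzRingType) k (a : S) (h : I -> S) : k \in D ->
  \prod_(i in D) with_value k a h i = a * \prod_(i in D | i != k) h i.
Proof.
move=> kD; rewrite (bigD1 k)//= with_value_at; congr (_ * _).
by apply: eq_bigr => i /andP[_ ik]; rewrite with_value_neq.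
Qed.

Lemma prod_with_value_out (S : comNzRingType) k (a : S) (h : I -> S) :
  k \notin D -> \prod_(i in D) with_value k a h i = \prod_(i in D) h i.
Proof.
move=> kD; apply: eq_bigr => i iD; rewrite with_value_neq//.
by apply: contraNneq kD => <-.
Qed.

Lemma measurable_prodX (h : I -> R -> R) (Q : pred I) :
  (forall i, measurable_fun setT (h i)) ->
  measurable_fun setT (fun w => \prod_(i in D | Q i) h i (X i w)).
Proof.
move=> mh; rewrite [X in measurable_fun _ X](_ : _ =
  fun w => \prod_(i <- index_enum I | (i \in D) && Q i) (h i \o X i) w)//.
under eq_fun do rewrite -big_filter.
apply: measurable_prod => i _.
apply: (measurableT_comp (mh i)); exact: measurable_funPT.
Qed.

Lemma expectation_prod_indic (B : I -> set R) : (forall i, measurable (B i)) ->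
  (\int[P]_w (\prod_(i in D) \1_(B i) (X i w))%:E
     = (\prod_(i in D) fine (P (X i @^-1` B i)))%:E)%E.
Proof.
move=> mB; have mX i : measurable (X i @^-1` B i).
  by rewrite -[X in measurable X]setTI; exact: measurable_funP.
have -> : (\prod_(i in D) fine (P (X i @^-1` B i)))%:E
    = P (\bigcap_(i in [set` D]) (X i @^-1` B i)).
  rewrite indep//; elim/big_rec2 : _ => //= i x y _ <-.
  by rewrite EFinM fineK// fin_num_measure.
rewrite -[in RHS](setIT (\bigcap_(i in _) _)) -integral_indic//; last first.
  by apply: fin_bigcap_measurable => //; exact: finite_finset.
apply: eq_integral => w _; congr EFin; rewrite indicE.
have [wB|wB] := boolP (w \in _).
  rewrite big1// => i iD; rewrite indicE mem_set//.
  by move/set_mem : wB; apply.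
have [i iD wi] : exists2 i, i \in D & ~ B i (X i w).
  apply: contrapT => H; move/negP : wB; apply; apply/mem_set => i /= iD.
  by apply: contrapT => wi; apply: H; exists i.
by rewrite (bigD1 i)//= indicE memNset// mul0r.
Qed.

(** Induction on the set K of coordinates whose function is not an indicator:
    replacing the function of one of them by an arbitrary indicator gives the
    hypothesis of [ge0_integral_weighted].  *)
Lemma ge0_expectation_prod (K : seq I) (h : I -> R -> R) (m : I -> R) :
  (forall i, measurable_fun setT (h i)) -> (forall i x, 0 <= h i x) ->
  (forall i, i \notin K -> exists2 B, measurable B & h i = \1_B) ->
  (forall i, (\int[P]_w (h i (X i w))%:E = (m i)%:E)%E) ->
  (\int[P]_w (\prod_(i in D) h i (X i w))%:E = (\prod_(i in D) m i)%:E)%E.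
Proof.
elim: K h m => [|k K IH] h m mh h0 hK hm.
  have /choice[B hB] : forall i, exists B, measurable B /\ h i = \1_B.
    by move=> i; have [//|B mB hB] := hK i; exists B.
  under eq_integral do under eq_bigr do rewrite (hB _).2.
  rewrite expectation_prod_indic; last by move=> i; exact: (hB i).1.
  congr EFin; apply: eq_bigr => i _; apply: EFin_inj.
  have mXi : measurable (X i @^-1` B i).
    by apply: measurable_funPTI; exact: (hB i).1.
  rewrite -hm fineK ?fin_num_measure// (hB i).2.
  transitivity (\int[P]_w (\1_(X i @^-1` B i) w)%:E)%E; last by [].
  by rewrite integral_indic// setIT.
have m0 i : 0 <= m i.
  by rewrite -lee_fin -hm; apply: integral_ge0 => w _; rewrite lee_fin.
pose p A := fine (P (X k @^-1` A)).
have IHk A : measurable A ->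
    (\int[P]_w (\prod_(i in D) with_value k \1_A h i (X i w))%:E
       = (\prod_(i in D) with_value k (p A) m i)%:E)%E.
  move=> mA; apply: IH => i.
  - by rewrite /with_value; case: eqP.
  - by rewrite /with_value; case: eqP.
  - move=> iK; rewrite /with_value; case: eqP => [_|/eqP ik]; first by exists A.
    by apply: hK; rewrite inE negb_or ik.
  - rewrite /with_value; case: eqP => [->|_]; last exact: hm.
    have mXk : measurable (X k @^-1` A) by exact: measurable_funPTI.
    transitivity (\int[P]_w (\1_(X k @^-1` A) w)%:E)%E; first by [].
    by rewrite integral_indic// setIT fineK// fin_num_measure.
have [kD|kD] := boolP (k \in D); last first.
  rewrite -(prod_with_value_out (p setT) m kD) -IHk//.
  apply: eq_integral => w _; congr EFin; apply: eq_bigr => i iD.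
  by rewrite with_value_neq//; apply: contraNneq kD => <-.
pose Z w := \prod_(i in D | i != k) h i (X i w).
transitivity (\int[P]_w (h k (X k w) * Z w)%:E)%E.
  by apply: eq_integral => w _; rewrite (bigD1 k).
rewrite [in RHS](bigD1 k)//= mulrC EFinM -hm.
rewrite -(ge0_integral_distribution _ (f := EFin \o h k))//=; last 2 first.
- exact/measurable_EFinP.
- by move=> y; rewrite lee_fin.
apply: ge0_integral_weighted => //.
- exact: measurable_prodX.
- by move=> w; exact: prodr_ge0.
move=> A mA.
transitivity (\int[P]_w (\prod_(i in D) with_value k \1_A h i (X i w))%:E)%E.
  apply: eq_integral => w _; congr EFin; rewrite (bigD1 k)//= with_value_at.
  by congr (_ * _); apply: eq_bigr => i /andP[_ ik]; rewrite with_value_neq.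
rewrite IHk// prod_with_value// EFinM muleC fineK// fin_num_measure//.
exact: measurable_funPTI.
Qed.

Lemma integrable_prod (h : I -> R -> R) :
  (forall i, measurable_fun setT (h i)) ->
  (forall i, P.-integrable setT (fun w => (h i (X i w))%:E)) ->
  P.-integrable setT (fun w => (\prod_(i in D) h i (X i w))%:E).
Proof.
move=> mh ih; apply/integrableP; split.
  apply/measurable_EFinP.
  rewrite [X in measurable_fun _ X](_ : _ = fun w =>
    \prod_(i in D | true) h i (X i w)); first exact: (measurable_prodX xpredT).
  by apply/funext => w; apply: eq_bigl => i; rewrite andbT.
pose m i := fine (\int[P]_w (`|h i (X i w)|%:E))%E.
rewrite (eq_integral (fun w => (\prod_(i in D) `|h i (X i w)|)%:E)); last first.
  by move=> w _; rewrite -normr_prod.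
rewrite (@ge0_expectation_prod (enum I) (fun i x => `|h i x|) m) ?ltry//.
- by move=> i; exact: measurableT_comp.
- by move=> i; rewrite mem_enum.
- move=> i; rewrite fineK// ge0_fin_numE; last first.
    by apply: integral_ge0 => w _; rewrite lee_fin.
  by have /integrableP[_] := ih i.
Qed.

(** Signs are introduced one coordinate at a time, K being the set of the
    coordinates whose function may change sign: that function is split into its
    positive and negative parts, both of which are nonnegative.  *)
Lemma expectation_prod_signed (K : seq I) (h : I -> R -> R) (m : I -> R) :
  (forall i, measurable_fun setT (h i)) ->
  (forall i, i \notin K -> forall x, 0 <= h i x) ->
  (forall i, P.-integrable setT (fun w => (h i (X i w))%:E)) ->
  (forall i, (\int[P]_w (h i (X i w))%:E = (m i)%:E)%E) ->
  (\int[P]_w (\prod_(i in D) h i (X i w))%:E = (\prod_(i in D) m i)%:E)%E.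
Proof.
elim: K h m => [|k K IH] h m mh h0 ih hm.
  apply: (@ge0_expectation_prod (enum I)) => //.
  - by move=> i; exact: h0.
  - by move=> i; rewrite mem_enum.
have [kD|kD] := boolP (k \in D); last first.
  rewrite -(prod_with_value_out 1 m kD).
  rewrite -(IH (with_value k (cst 1) h) (with_value k 1 m)).
  - apply: eq_integral => w _; congr EFin; apply: eq_bigr => i iD.
    by rewrite with_value_neq//; apply: contraNneq kD => <-.
  - by move=> i; rewrite /with_value; case: eqP.
  - move=> i iK x; rewrite /with_value; case: eqP => // /eqP ik.
    by apply: h0; rewrite inE negb_or ik.
  - move=> i; rewrite /with_value; case: eqP => // _.
    exact: finite_measure_integrable_cst.
  - move=> i; rewrite /with_value; case: eqP => // _.
    by have := @integral_cst _ _ _ P _ measurableT 1; rewrite /= => ->;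
      rewrite mul1e probability_setT.
pose hp x := Num.max (h k x) 0; pose hn x : R := Num.max (- h k x) 0.
have mhp : measurable_fun setT hp by exact: measurable_maxr.
have mhn : measurable_fun setT hn.
  by apply: measurable_maxr => //; exact: measurableT_comp.
have part (g : R -> R) (mg : measurable_fun setT g) (g0 : forall x, 0 <= g x)
    (gh : forall x, g x <= `|h k x|) :
    [/\ P.-integrable setT (fun w => (g (X k w))%:E),
      P.-integrable setT (fun w =>
        (\prod_(i in D) with_value k g h i (X i w))%:E) &
      (\int[P]_w (\prod_(i in D) with_value k g h i (X i w))%:E =
       (fine (\int[P]_w (g (X k w))%:E) * \prod_(i in D | i != k) m i)%:E)%E].
  have ig : P.-integrable setT (fun w => (g (X k w))%:E).
    apply: le_integrable (ih k) => //.
      apply/measurable_EFinP; apply: (measurableT_comp mg).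
      exact: measurable_funPT.
    by move=> w _; rewrite lee_fin ger0_norm.
  have mgh i : measurable_fun setT (with_value k g h i).
    by rewrite /with_value; case: eqP.
  have igh i : P.-integrable setT (fun w => (with_value k g h i (X i w))%:E).
    by rewrite /with_value; case: eqP => [->|].
  split => //; first exact: integrable_prod.
  rewrite -prod_with_value//; apply: IH => // i.
    move=> iK x; rewrite /with_value; case: eqP => // /eqP ik.
    by apply: h0; rewrite inE negb_or ik.
  rewrite /with_value; case: eqP => // ->; rewrite fineK//.
  exact: integrable_fin_num.
have [|x|x|igp iPp Ep] := part hp => //; first by rewrite le_max lexx orbT.
  by rewrite ge_max ler_norm normr_ge0.
have [|x|x|ign iPn En] := part hn => //; first by rewrite le_max lexx orbT.
  by rewrite ge_max -normrN ler_norm normr_ge0.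
have hE x : h k x = hp x - hn x.
  rewrite /hp /hn; have [h_ge0|h_le0] := leP 0 (h k x).
    by rewrite [Num.max (- _) _]max_r ?oppr_le0// subr0.
  by rewrite max_l ?oppr_ge0 ?(ltW h_le0)// opprK add0r.
transitivity (\int[P]_w ((\prod_(i in D) with_value k hp h i (X i w))%:E -
   (\prod_(i in D) with_value k hn h i (X i w))%:E))%E.
  apply: eq_integral => w _; rewrite -EFinB; congr EFin.
  rewrite !(bigD1 k kD)/= !with_value_at hE mulrBl; congr (_ * _ - _ * _);
  by apply: eq_bigr => i /andP[_ ik]; rewrite with_value_neq.
rewrite integralB// Ep En -EFinB; congr EFin.
rewrite -mulrBl (bigD1 k kD)/=; congr (_ * _).
apply: EFin_inj; rewrite -hm EFinB !fineK ?integrable_fin_num//.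
rewrite -integralB//; apply: eq_integral => w _.
by rewrite -EFinB -hE.
Qed.

End IndependentProduct.

(** * Gaussian moments *)

Section GaussianMoments.
Context {R : realType} (v : R).
Hypothesis v_gt0 : 0 < v.
Let s := Num.sqrt v.
Let w := normal_pdf 0 s.

Let s_neq0 : s != 0. Proof. by rewrite gt_eqF// sqrtr_gt0. Qed.
Let s2 : s ^+ 2 = v. Proof. by rewrite sqr_sqrtr// ltW. Qed.

Lemma centered_normal_pdfE x :
  w x = normal_peak s * expR (- (x ^+ 2 / (2 * v))).
Proof.
by rewrite /w normal_pdfE// /normal_fun subr0 s2 mulNr (mulr_natl v).
Qed.

Let is_derive_exponent (x : R) :
  is_derive x 1 (fun y : R => - (y ^+ 2 / (2 * v))) (- (x / v)).
Proof.
rewrite [X in is_derive _ _ X](_ : _ =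
  (- (2 * v)^-1) *: ((id : R -> R) ^+ 2)); last first.
  by apply/funext => y; rewrite !fctE /GRing.scale/= mulNr mulrC.
apply: is_derive_eq.
rewrite /GRing.scale/= mulr1 expr1 mulNr; congr (- _).
by rewrite invfM mulrAC mulrA mulVf ?mul1r ?pnatr_eq0 1?mulrC.
Qed.

Let is_derive_pow k (x : R) :
  is_derive x 1 (fun y : R => y ^+ k.+1) (k.+1%:R * x ^+ k).
Proof.
rewrite [X in is_derive _ _ X](_ : _ = ((id : R -> R) ^+ k.+1)); last first.
  by apply/funext => y; rewrite !fctE.
by apply: is_derive_eq; rewrite /GRing.scale/= mulr1.
Qed.

Let is_derive_density (x : R) : is_derive x 1 (fun y => - v * w y) (x * w x).
Proof.
rewrite [X in is_derive _ _ X](_ : _ = (- v * normal_peak s) *: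
   (expR \o (fun y : R => - (y ^+ 2 / (2 * v))))); last first.
  by apply/funext => y; rewrite !fctE centered_normal_pdfE mulrA.
have H := is_derive1_comp (is_derive_expR _) (is_derive_exponent x).
apply: is_derive_eq.
rewrite /GRing.scale/= centered_normal_pdfE.
by field; rewrite gt_eqF.
Qed.

Let continuous_density : continuous w.
Proof. exact: continuous_normal_pdf. Qed.

Let continuous_pow_density k : continuous (fun x : R => x ^+ k * w x).
Proof. by move=> x; apply: cvgM; [exact: exprn_continuous|exact: continuous_density]. Qed.

(** The bound is far from sharp, but it is all that is needed for the boundary
    term of the integration by parts to vanish: the exponential of
    y = x ^ 2 / (2 v) is at least y ^ (k + 1) / (k + 1)!.  *)
Let pow_density_le k (x : R) : 1 <= x ->
  x ^+ k.+1 * w x <= normal_peak s * ((k.+1)`!%:R * (2 * v) ^+ k.+1) * x^-1.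
Proof.
move=> x1; have x0 : 0 < x by exact: lt_le_trans x1.
have vv0 : 0 < 2 * v by rewrite mulr_gt0.
rewrite centered_normal_pdfE mulrCA -mulrA ler_wpM2l ?normal_peak_ge0//.
rewrite expRN.
set y := x ^+ 2 / _; have y_gt0 : 0 < y by apply: divr_gt0 => //; exact: exprn_gt0.
have y0 := ltW y_gt0.
have fact_gt0R : 0 < (k.+1)`!%:R :> R by rewrite ltr0n fact_gt0.
have Hy : y ^+ k.+1 / (k.+1)`!%:R <= expR y.
  by apply: le_trans (expR_ge1Dxn k y0); rewrite lerDr.
apply: (@le_trans _ _ (x ^+ k.+1 * (y ^+ k.+1 / (k.+1)`!%:R)^-1)).
  rewrite ler_wpM2l ?exprn_ge0 ?(ltW x0)// lef_pV2// posrE ?expR_gt0//.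
  by rewrite divr_gt0 ?exprn_gt0.
rewrite invf_div /y expr_div_n.
have -> : x ^+ k.+1 * ((k.+1)`!%:R / ((x ^+ 2) ^+ k.+1 / (2 * v) ^+ k.+1)) =
  (k.+1)`!%:R * (2 * v) ^+ k.+1 * (x ^+ k.+1)^-1.
  rewrite -exprM mulnC exprM; field.
  by rewrite !expf_neq0 ?gt_eqF.
rewrite ler_wpM2l ?mulr_ge0 ?exprn_ge0 ?(ltW vv0) ?(ltW fact_gt0R)//.
rewrite lef_pV2 ?posrE ?exprn_gt0// exprS ler_peMr ?(ltW x0)//.
exact: exprn_ege1.
Qed.

Let cvg_pow_density k : (n.+1%:R ^+ k.+1 * w n.+1%:R) @[n --> \oo] --> (0 : R).
Proof.
set C := normal_peak s * ((k.+1)`!%:R * (2 * v) ^+ k.+1).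
apply: (@squeeze_cvgr _ _ _ _ (cst 0) (fun n => C * n.+1%:R^-1)).
- near=> n; apply/andP; split.
    by rewrite mulr_ge0 ?exprn_ge0 ?normal_pdf_ge0.
  by apply: pow_density_le; rewrite ler1n.
- exact: cvg_cst.
- rewrite -[X in _ --> X](mulr0 C); apply: cvgMr.
  exact: cvg_harmonic.
Unshelve. all: by end_near. Qed.

Definition half_moment k := (\int[lebesgue_measure]_(x in `[0%R, +oo[) (x ^+ k * w x)%:E)%E.

Let half_moment_cvg k :
  (\int[lebesgue_measure]_(x in `[0%R, n.+1%:R]) (x ^+ k * w x)%:E)%E @[n --> \oo]
  --> half_moment k.
Proof.
rewrite /half_moment (_ : `[0%R, +oo[%classic =
    \bigcup_n (`[0%R, n.+1%:R]%classic : set R)); last first.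
  apply/seteqP; split => x /=.
    rewrite in_itv/= andbT => x0; exists (Num.truncn x) => //=.
    by rewrite in_itv/= x0 ltW// truncnS_gt.
  by case=> n _ /=; rewrite !in_itv/= => /andP[->].
apply: ge0_nondecreasing_set_cvg_integral => //.
- apply/nondecreasing_seqP => n; apply/subsetPset => x /=.
  rewrite !in_itv/= => /andP[-> /le_trans]; apply.
  by rewrite ler_nat.
- move=> n; apply/measurable_EFinP; apply: measurable_funTS.
  exact: continuous_measurable_fun.
- move=> n x /=; rewrite in_itv/= => /andP[x0 _].
  by rewrite lee_fin mulr_ge0 ?exprn_ge0 ?normal_pdf_ge0.
Qed.

(** Integration by parts on a bounded interval, with x ^ (k + 1) and the
    primitive - v w of x w(x), followed by a passage to the limit.  *)
Lemma half_momentSS k a : half_moment k = a%:E ->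
  half_moment k.+2 = (v * k.+1%:R * a)%:E.
Proof.
move=> ka.
rewrite -(cvg_lim (@ereal_hausdorff _) (@half_moment_cvg k.+2)).
apply/cvg_lim => //.
have byparts n : (\int[lebesgue_measure]_(x in `[0%R, n.+1%:R]) (x ^+ k.+2 * w x)%:E
   = (- v * (n.+1%:R ^+ k.+1 * w n.+1%:R))%:E + (v * k.+1%:R)%:E *
     \int[lebesgue_measure]_(x in `[0%R, n.+1%:R]) (x ^+ k * w x)%:E)%E.
  transitivity (\int[lebesgue_measure]_(x in `[0%R, n.+1%:R]) (x ^+ k.+1 * (x * w x))%:E)%E.
    by apply: eq_integral => x _; rewrite mulrA -exprSr.
  have cdiff (f : R -> R) df (x : R) : is_derive x 1 f df -> {for x, continuous f}.
    by move=> [dx _]; apply/differentiable_continuous/derivable1_diffP.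
  have LR (f df : R -> R) : (forall x : R, is_derive x 1 f (df x)) ->
      derivable_oo_LRcontinuous f 0 n.+1%:R.
    move=> Df; split => [x _||]; first by have [] := Df x.
    - by apply: cvg_at_right_filter; exact: cdiff (Df _).
    - by apply: cvg_at_left_filter; exact: cdiff (Df _).
  rewrite (@integration_by_parts _ _ (fun y => - v * w y)
     (fun x => k.+1%:R * x ^+ k)) //.
  - rewrite expr0n/= mul0r subr0 mulrCA; congr (_ + _)%E.
    rewrite (_ : (fun x => _) =
      (fun x => (- (v * k.+1%:R))%:E * (x ^+ k * w x)%:E)%E); last first.
      by apply/funext => x; rewrite -EFinM; congr EFin; ring.
    rewrite integralZl//; first by rewrite EFinN mulNe oppeK.
    apply: continuous_compact_integrable; first exact: segment_compact.
    exact: continuous_subspaceT.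
  - apply: continuous_subspaceT => x; apply: cvgM; first exact: cvg_cst.
    exact: exprn_continuous.
  - apply: LR; exact: is_derive_pow.
  - by move=> x _; rewrite derive1E; have [_ ->] := is_derive_pow k x.
  - apply: continuous_subspaceT => x; apply: cvgM; first exact: cvg_id.
    exact: continuous_density.
  - apply: LR; exact: is_derive_density.
  - by move=> x _; rewrite derive1E; have [_ ->] := is_derive_density x.
under eq_fun do rewrite byparts.
have -> : (v * k.+1%:R * a)%:E =
    ((- v)%:E * 0%:E + (v * k.+1%:R)%:E * half_moment k)%E.
  by rewrite mule0 add0e ka EFinM.
apply: cvgeD => //.
  under eq_fun do rewrite EFinM.
  apply: cvgeZl => //.
  by apply: cvg_EFin; [exact: nearW|exact: cvg_pow_density].
by apply: cvgeZl => //; exact: half_moment_cvg.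
Qed.

End GaussianMoments.

(** The moments of the centered Gaussian law of variance v; the recursion is
    Gaussian integration by parts, and also what the recursion of the hafnian
    produces.  *)
Fixpoint gauss_moment (R : realType) (v : R) (k : nat) : R :=
  match k with
  | 0 => 1
  | 1 => 0
  | k'.+2 => v * k'.+1%:R * gauss_moment v k'
  end.

Lemma gauss_moment_odd (R : realType) (v : R) k : odd k -> gauss_moment v k = 0.
Proof.
elim/ltn_ind: k => -[|[|k]]//= IH; rewrite negbK => ok.
by rewrite IH ?mulr0.
Qed.

Lemma gauss_momentZ (R : realType) (c v : R) k :
  gauss_moment (c ^+ 2 * v) k = c ^+ k * gauss_moment v k.
Proof.
elim/ltn_ind: k => -[|[|k]]/= IH; rewrite ?expr0 ?mul1r ?mulr0//.
by rewrite IH// !exprS; ring.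
Qed.

Section GaussianLaw.
Context {R : realType} (v : R).
Hypothesis v_gt0 : 0 < v.
Let w := normal_pdf 0 (Num.sqrt v).

Lemma half_moment_even k :
  half_moment v k.*2 = (2^-1 * gauss_moment v k.*2)%:E.
Proof.
elim: k => [|k IH].
  have H : (2%:E * half_moment v 0 = 1)%E.
    rewrite -(integral_normal_pdf 0 (Num.sqrt v)) ge0_symfun_integralT.
    - rewrite -set_itvcy; congr (_ * _)%E; apply: eq_integral => x _.
      by rewrite expr0 mul1r.
    - by move=> x; exact: normal_pdf_ge0.
    - by apply: continuous_normal_pdf; rewrite gt_eqF// sqrtr_gt0.
    - by move=> x; rewrite /= !centered_normal_pdfE// sqrrN.
  have : (2^-1%:E * (2%:E * half_moment v 0) = 2^-1%:E * 1)%E by rewrite H.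
  by rewrite muleA -EFinM mulVf// mul1e mule1 /= mulr1.
by rewrite doubleS (half_momentSS v_gt0 IH); congr EFin => /=; ring.
Qed.

Lemma ge0_integral_gaussian_law (h : R -> R) : measurable_fun setT h ->
  (forall x, 0 <= h x) ->
  (\int[gaussian_law v]_x (h x)%:E
     = \int[lebesgue_measure]_x (h x * w x)%:E)%E.
Proof.
move=> mh h0.
rewrite -[LHS]mul1e.
rewrite -(@ge0_integral_weighted _ _ _ _ R lebesgue_measure (gaussian_law v) id w 1)//.
- exact: measurable_normal_pdf.
- by move=> x; exact: normal_pdf_ge0.
move=> A mA; rewrite mul1e.
rewrite /gaussian_law /normal_prob/= [RHS]integral_mkcond.
by apply: eq_integral => x _; rewrite patchE indicE; case: (x \in A);
  rewrite ?mul1r ?mul0r.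
Qed.

Lemma gaussian_law_even_moment k :
  (\int[gaussian_law v]_x (x ^+ k.*2)%:E = (gauss_moment v k.*2)%:E)%E.
Proof.
rewrite ge0_integral_gaussian_law//; last first.
  by move=> x; rewrite -mul2n exprM exprn_ge0// sqr_ge0.
rewrite (@ge0_symfun_integralT _ (fun x => x ^+ k.*2 * w x)).
- rewrite -set_itvcy -/(half_moment v k.*2) half_moment_even.
  by rewrite -EFinM mulrA divff// mul1r.
- move=> x; rewrite mulr_ge0 ?normal_pdf_ge0//.
  by rewrite -mul2n exprM exprn_ge0// sqr_ge0.
- move=> x; apply: cvgM; first exact: exprn_continuous.
  by apply: continuous_normal_pdf; rewrite gt_eqF// sqrtr_gt0.
- move=> x; rewrite /= /w !centered_normal_pdfE// sqrrN.
  by rewrite -mul2n !exprM sqrrN.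
Qed.

Lemma gaussian_law_sym (A : set R) : measurable A ->
  gaussian_law v (-%R @^-1` A) = gaussian_law v A.
Proof.
move=> mA; have mNA : measurable (-%R @^-1` A).
  by rewrite -[X in measurable X]setTI; exact: oppr_measurable.
transitivity (\int[gaussian_law v]_x (\1_A (- x))%:E)%E.
  transitivity (\int[gaussian_law v]_x (\1_(-%R @^-1` A) x)%:E)%E; last by [].
  by rewrite integral_indic ?setIT.
rewrite -[in RHS](setIT A) -integral_indic//.
have mg : measurable_fun setT (fun x : R => \1_A x * w x).
  by apply: measurable_funM => //; exact: measurable_normal_pdf.
have mI : measurable_fun setT (fun x : R => \1_A (- x) : R).
  by apply: (measurableT_comp (f := \1_A : R -> R)) => //; exact: oppr_measurable.
rewrite (ge0_integral_gaussian_law mI)// ge0_integral_gaussian_law//.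
transitivity (\int[pushforward lebesgue_measure (-%R : R -> measurableTypeR R)]_x
    (\1_A x * w x)%:E)%E.
  rewrite ge0_integral_pushforward//=.
  - apply: eq_integral => x _.
    by rewrite /= /w !centered_normal_pdfE// sqrrN.
  - exact/measurable_EFinP.
  - by move=> x _; rewrite lee_fin mulr_ge0// normal_pdf_ge0.
by apply: eq_measure_integral => B mB _; exact: lebesgue_measureN.
Qed.

End GaussianLaw.

(** * Moments of symmetric and of Gaussian variables *)

Section Moments.
Context {R : realType} {disp : measure_display} {T : measurableType disp}.
Context {P : probability T R} (Z : {RV P >-> R}).

Lemma integral_has_law
    (mu : {measure set (measurableTypeR R) -> \bar R}) (h : R -> R) :
  has_law Z mu -> measurable_fun setT h -> (forall x, 0 <= h x) ->
  (\int[P]_w (h (Z w))%:E = \int[mu]_x (h x)%:E)%E.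
Proof.
move=> lawZ mh h0.
rewrite -[RHS]mul1e -(@ge0_integral_weighted _ _ _ _ R P mu Z (cst 1) 1)//.
- by apply: eq_integral => w _; rewrite mulr1.
- exact (@measurable_funPT _ _ _ _ Z).
move=> A mA; rewrite mul1e -lawZ//.
transitivity (\int[P]_w (\1_(Z @^-1` A) w)%:E)%E.
  by apply: eq_integral => w _; rewrite mulr1.
by rewrite integral_indic ?setIT//; exact: measurable_funPTI.
Qed.

Hypothesis even_moments : forall k, (\int[P]_w (Z w ^+ k.*2)%:E < +oo)%E.

(** The absolute value of x ^ k is at most 1 + x ^ (2 k).  *)
Lemma integrable_RV_pow k : P.-integrable setT (fun w => (Z w ^+ k)%:E).
Proof.
have mZ j : measurable_fun setT (fun w => Z w ^+ j) by exact: measurable_funX.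
have even_ge0 (x : R) : 0 <= x ^+ k.*2.
  by rewrite -mul2n exprM exprn_ge0// sqr_ge0.
have i2 : P.-integrable setT (fun w => (Z w ^+ k.*2)%:E).
  apply/integrableP; split; first exact/measurable_EFinP.
  by under eq_integral do rewrite gee0_abs ?lee_fin//.
have i1 : P.-integrable setT (EFin \o cst (1:R)).
  exact: finite_measure_integrable_cst.
apply: le_integrable (integrableD measurableT i1 i2) => //.
  exact/measurable_EFinP.
move=> w _ /=; rewrite lee_fin [leRHS]ger0_norm; last by rewrite addr_ge0.
rewrite normrX -addnn exprD.
have -> : Z w ^+ k * Z w ^+ k = `|Z w| ^+ k ^+ 2.
  by rewrite -normrX real_normK ?num_real// expr2.
set a := _ ^+ k; have : 0 <= (a - 1) ^+ 2 by exact: sqr_ge0.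
have : 0 <= a by exact: exprn_ge0.
nra.
Qed.

Lemma odd_moment_sym k : symmetrically_distributed Z -> odd k ->
  (\int[P]_w (Z w ^+ k)%:E = 0)%E.
Proof.
move=> symZ ok; have iZ := integrable_RV_pow k.
have mk : measurable_fun setT (fun x : R => (x ^+ k)%:E).
  by apply/measurable_EFinP; exact: measurable_funX.
have mNZ : measurable_fun setT (\- Z).
  exact: (measurableT_comp (@oppr_measurable R setT) (measurable_funPT Z)).
have E1 : (\int[P]_w (Z w ^+ k)%:E = \int[P]_w ((- Z w) ^+ k)%:E)%E.
  rewrite -(integral_distribution (f := fun x : R => (x ^+ k)%:E))//.
  transitivity (\int[pushforward P (\- Z)%R]_y (y ^+ k)%:E)%E.
    by apply: eq_measure_integral => A mA _; exact: symZ.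
  rewrite integral_pushforward//.
  rewrite [X in integrable _ _ X](_ : _ = (fun w => - (Z w ^+ k)%:E)%E).
    exact: integrableN.
  by apply/funext => w; rewrite /= exprNn -signr_odd ok expr1 mulN1r.
have Efin := integrable_fin_num measurableT iZ.
move: E1; under [in RHS]eq_integral do
  rewrite exprNn -signr_odd ok expr1 mulN1r EFinN.
rewrite integralN/=; last exact: integrable_add_def.
rewrite -(fineK Efin) => -[]; set a := fine _ => H; congr EFin; lra.
Qed.

End Moments.

Lemma has_gaussian_law_moment (R : realType) (disp : measure_display)
    (T : measurableType disp) (P : probability T R) (Z : {RV P >-> R}) (v : R) :
  0 < v -> has_law Z (gaussian_law v) -> forall k,
  P.-integrable setT (fun w => (Z w ^+ k)%:E) /\
  (\int[P]_w (Z w ^+ k)%:E = (gauss_moment v k)%:E)%E.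
Proof.
move=> v0 lawZ k.
have even j : (\int[P]_w (Z w ^+ j.*2)%:E = (gauss_moment v j.*2)%:E)%E.
  rewrite -gaussian_law_even_moment//.
  apply: (integral_has_law (mu := gaussian_law v) (h := fun x => x ^+ j.*2) lawZ) => // x.
  by rewrite -mul2n exprM exprn_ge0// sqr_ge0.
have fin j : (\int[P]_w (Z w ^+ j.*2)%:E < +oo)%E by rewrite even ltry.
split; first exact: integrable_RV_pow.
have [ok|ek] := boolP (odd k); last by rewrite -(even_halfK ek) even.
rewrite gauss_moment_odd// odd_moment_sym// => A mA.
rewrite lawZ// -gaussian_law_sym// -lawZ//.
by rewrite -[X in measurable X]setTI; exact: oppr_measurable.
Qed.

(** * Wick's formula *)

Section Hafnian.
Context {R : realType} {A : eqType}.
Implicit Types (C : A -> A -> R) (s : seq A).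

(** Sum over the perfect matchings of s, obtained by choosing the partner y of
    the head.  The list being shortened by [rem] is not a structural subterm,
    hence the bound N on the depth.  A list of odd size has no perfect matching:
    the recursion ends on an empty sum.  *)
Fixpoint hafnian_rec (N : nat) C s : R :=
  if N is N'.+1 then
    if s is x :: s' then
      \sum_(y <- s') C x y * hafnian_rec N' C (rem y s')
    else 1
  else 1.

Definition hafnian C s := hafnian_rec (size s) C s.

Lemma hafnian_rec_enough C N s : (size s <= N)%N ->
  hafnian_rec N C s = hafnian C s.
Proof.
rewrite /hafnian; elim/ltn_ind: N s => -[|N] IH [|x s]//= sN.
apply: eq_big_seq => y ys; congr (_ * _).
have s_gt0 : (0 < size s)%N by case: s ys {sN}.
have sz := size_rem ys.
by rewrite IH//= ?[in RHS]IH// ?sz; lia.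
Qed.

Lemma hafnian_cons C x s :
  hafnian C (x :: s) = \sum_(y <- s) C x y * hafnian C (rem y s).
Proof.
rewrite {1}/hafnian /=; apply: eq_big_seq => y ys; congr (_ * _).
by rewrite hafnian_rec_enough// size_rem//; lia.
Qed.

Lemma eq_hafnian C C' s : (forall x y, C x y = C' x y) ->
  hafnian C s = hafnian C' s.
Proof. by move=> CC'; congr (hafnian _ s); apply/funext => x; apply/funext. Qed.

(** Wick's formula for independent variables of variances v: matching the head
    with one of the c other occurrences of its label is the recursion of
    [gauss_moment].  *)
Lemma hafnian_diagonal (I : finType) (lab : A -> I) (v : I -> R) s :
  hafnian (fun x y => if lab x == lab y then v (lab x) else 0) s
  = \prod_(i : I) gauss_moment (v i) (count (fun x => lab x == i) s).
Proof.
have [N] := ubnP (size s); elim: N s => // N IH [|x s] /= sN.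
  by rewrite /hafnian/= big1.
rewrite hafnian_cons.
set a := lab x; pose cnt i := count (fun x => lab x == i) s.
pose Z := \prod_(i | i != a) gauss_moment (v i) (cnt i).
transitivity (\sum_(y <- s | lab y == a) v a * gauss_moment (v a) (cnt a).-1 * Z).
  rewrite [RHS]big_mkcond; apply: eq_big_seq => y ys /=.
  rewrite eq_sym; case: eqP => [ya|_]; last by rewrite mul0r.
  rewrite IH; last by rewrite size_rem//; lia.
  rewrite -mulrA (bigD1 a)//=; congr (_ * (_ * _)).
    by rewrite count_rem ys ya eqxx subn1.
  by apply: eq_bigr => i ia; rewrite count_rem ys ya eq_sym (negbTE ia) subn0.
rewrite big_const_seq iter_addr_0 -/(cnt a) [RHS](bigD1 a)//= eqxx add1n.
have -> : \prod_(i | i != a) gauss_moment (v i) ((a == i) + cnt i) = Z.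
  by apply: eq_bigr => i ia; rewrite eq_sym (negbTE ia).
rewrite -/(cnt a); case: (cnt a) => [|c]/=; first by rewrite mulr0n mul0r.
by rewrite -mulr_natr; ring.
Qed.

End Hafnian.

(** * Words constrained by an equivalence of positions *)

Fixpoint words (A : finType) (t : nat) : seq (seq A) :=
  if t is t'.+1 then [seq rcons s a | s <- words A t', a <- enum A] else [:: [::]].

Lemma size_words (A : finType) t s : s \in words A t -> size s = t.
Proof.
elim: t s => [|t IH] s; first by rewrite inE => /eqP ->.
by move=> /allpairsP[[s' a] [/= /IH <- _ ->]]; rewrite size_rcons.
Qed.

Lemma sum_wordsS (A : finType) (V : nmodType) t (F : seq A -> V) :
  \sum_(s <- words A t.+1) F s = \sum_(s <- words A t) \sum_(a : A) F (rcons s a).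
Proof. by rewrite /= big_allpairs_dep; under eq_bigr do rewrite big_enum. Qed.

Definition respects (A : eqType) (x0 : A) (r : nat -> nat) (t : nat) (s : seq A) :=
  all (fun k => nth x0 s k == nth x0 s (r k)) (iota 0 t).

Definition satisfies (A : eqType) (x0 : A) (E : seq (nat * nat)) (s : seq A) :=
  all (fun e => nth x0 s e.1 == nth x0 s e.2) E.

(** The equalities between letters imposed by E all say that each letter is
    equal to the one at the least position of its class for the equivalence
    generated by E.  The function r sending a position to that least position is
    built by merging the classes of the two ends of each pair of E.  *)
Lemma least_representative (m : nat) (E : seq (nat * nat)) :
  (forall e, e \in E -> (e.1 < m)%N && (e.2 < m)%N) ->
  exists r : nat -> nat,
    [/\ forall k, (r k <= k)%N, forall k, r (r k) = r k,
        forall e, e \in E -> r e.1 = r e.2 &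
        forall (A : eqType) (x0 : A) s, satisfies x0 E s = respects x0 r m s].
Proof.
elim: E => [|[a b] E IH] Em.
  exists id; split => // A x0 s; symmetry; apply/allP => k _ /=; exact: eqxx.
have [|r [r_le rr rE rP]] := IH; first by move=> e eE; apply: Em; rewrite inE eE orbT.
have /andP[/= am bm] := Em (a, b) (mem_head _ _).
pose lo := minn (r a) (r b); pose hi := maxn (r a) (r b).
pose r' k := if r k == hi then lo else r k.
have lo_hi : (lo <= hi)%N by rewrite /lo /hi; lia.
have r_lo : r lo = lo by rewrite /lo /minn; case: ifP.
have r_hi : r hi = hi by rewrite /hi /maxn; case: ifP.
have r'a : r' a = lo by rewrite /r' /lo /hi; case: eqP => //; lia.
have r'b : r' b = lo by rewrite /r' /lo /hi; case: eqP => //; lia.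
(* r' maps to lo the positions that r maps to hi, and agrees with r elsewhere *)
exists r'; split.
- by move=> k; rewrite /r'; have := r_le k; case: eqP; lia.
- move=> k; rewrite /r'; have [rk|rk] := eqVneq (r k) hi.
    by rewrite r_lo; case: eqP.
  by rewrite rr (negbTE rk).
- move=> e; rewrite inE => /orP[/eqP -> /=|eE]; first by rewrite r'a r'b.
  by rewrite /r' (rE _ eE).
move=> A x0 s; rewrite /satisfies/= -/(satisfies x0 E s) rP.
set f := nth x0 s.
apply/andP/allP => [[/eqP fab /allP fr] k km|fr'].
  have frk j : (j < m)%N -> f j = f (r j).
    by move=> jm; apply/eqP/fr; rewrite mem_iota.
  have flohi : f lo = f hi.
    by move: fab; rewrite (frk a)// (frk b)// /lo /hi /minn /maxn; case: ltnP.
  have {}km : (k < m)%N by move: km; rewrite mem_iota.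
  apply/eqP; rewrite -/f /r'; case: eqP => [rk|_]; last exact: frk.
  by rewrite flohi -rk; exact: frk.
have fr'k j : (j < m)%N -> f j = f (r' j).
  by move=> jm; apply/eqP/fr'; rewrite mem_iota.
split; first by rewrite fr'k// r'a [eqbRHS]fr'k// r'b.
have hi_m : (hi < m)%N by rewrite /hi; have := r_le a; have := r_le b; lia.
have fhi : f hi = f lo by rewrite fr'k// /r' r_hi eqxx.
apply/allP => k; rewrite mem_iota => /= km; apply/eqP.
by rewrite -/f fr'k// /r'; case: eqP => // ->.
Qed.

(** * The spanning tree bound *)

Section TreeBound.
Context {R : realType}.

(** When r sends a position to the least position of its class, k is a first
    occurrence if r k = k; the sides that end at a first occurrence other than
    the starting point are those of a spanning tree of the glued polygon.  *)
Definition tree_weight (A : finType) (x0 : A) (b : A -> A -> R) (r : nat -> nat)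
    (s : seq A) (k : nat) : R :=
  if (0 < k)%N && (r k == k) then b (nth x0 s k.-1) (nth x0 s k) ^+ 2 else 1.

Definition tree_sum (A : finType) (x0 : A) (b : A -> A -> R) r t : R :=
  \sum_(s <- words A t)
    (respects x0 r t s)%:R * \prod_(k <- iota 0 t) tree_weight x0 b r s k.

(** The last letter is free if its position is a first occurrence, and otherwise
    forced by the previous ones.  *)
Lemma tree_sumS (A : finType) (x0 : A) (b : A -> A -> R) r t :
  (forall k, (r k <= k)%N) ->
  tree_sum x0 b r t.+1 = \sum_(s <- words A t)
    (respects x0 r t s)%:R * (\prod_(k <- iota 0 t) tree_weight x0 b r s k)
    * (if r t == t then \sum_(a : A) (if t is 0 then 1 else b (last x0 s) a ^+ 2)
       else 1).
Proof.
move=> r_le; rewrite /tree_sum sum_wordsS; apply: eq_big_seq => s sw.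
have ss := size_words sw.
have old k a : (k < t)%N -> nth x0 (rcons s a) k = nth x0 s k.
  by rewrite nth_rcons ss => ->.
have new a : nth x0 (rcons s a) t = a by rewrite nth_rcons ss ltnn eqxx.
have resp a : respects x0 r t.+1 (rcons s a) =
    respects x0 r t s && (a == nth x0 (rcons s a) (r t)).
  rewrite /respects -addn1 iotaD all_cat/= andbT add0n new; congr (_ && _).
  apply: eq_in_all => k; rewrite mem_iota add0n => /andP[_ kt].
  by rewrite !old// (leq_ltn_trans (r_le k)).
have weight a : \prod_(k <- iota 0 t.+1) tree_weight x0 b r (rcons s a) k =
    (\prod_(k <- iota 0 t) tree_weight x0 b r s k) *
    tree_weight x0 b r (rcons s a) t.
  rewrite -addn1 iotaD big_cat/= big_seq1 add0n; congr (_ * _).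
  apply: eq_big_seq => k; rewrite mem_iota add0n => /andP[_ kt].
  by rewrite /tree_weight; case: ifP => // _; rewrite !old//; lia.
rewrite (eq_bigr (fun a => (respects x0 r t s)%:R *
    (\prod_(k <- iota 0 t) tree_weight x0 b r s k) *
    ((a == nth x0 (rcons s a) (r t))%:R * tree_weight x0 b r (rcons s a) t)));
  last by move=> a _; rewrite resp weight -mulnb natrM mulrACA.
rewrite -mulr_sumr; congr (_ * _).
have [rt|rt] := eqVneq (r t) t.
  apply: eq_bigr => a _; rewrite rt new eqxx mul1r /tree_weight rt eqxx andbT.
  case: t {resp weight rt} old new ss sw => //= t old new ss sw.
  by rewrite new old// -nth_last ss.
have {}rt : (r t < t)%N by rewrite ltn_neqAle rt r_le.
rewrite (bigD1 (nth x0 s (r t)))//= old// eqxx mul1r.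
rewrite /tree_weight (ltn_eqF rt) andbF big1 ?addr0// => a at_.
by rewrite old// (negbTE at_) mul0r.
Qed.

(** Both sides are computed by adding letters one at a time: at a first
    occurrence the right-hand side is multiplied by #|B| and the left-hand side
    by at most that, and both are unchanged at the other positions.  The base
    case is one letter: with no letter the inequality would be #|B| <= #|A|.  *)
Lemma tree_sum_le (A B : finType) (x0 : A) (y0 : B) (b : A -> A -> R) r t :
  (forall k, (r k <= k)%N) ->
  (forall x, \sum_(y : A) b x y ^+ 2 <= #|B|%:R) ->
  #|B|%:R * tree_sum x0 b r t.+1
    <= #|A|%:R * \sum_(s <- words B t.+1) (respects y0 r t.+1 s)%:R.
Proof.
move=> r_le brow.
have count_tree (u : nat) : \sum_(s <- words B u) (respects y0 r u s)%:R =
    tree_sum y0 (fun _ _ : B => 1) r u.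
  apply: eq_bigr => s _; rewrite big1 ?mulr1// => k _.
  by rewrite /tree_weight expr1n if_same.
rewrite count_tree; elim: t => [|t IH].
  have r0 : r 0%N = 0%N by apply/eqP; rewrite -leqn0.
  rewrite !tree_sumS// r0 /= !big_seq1 /respects/= !big_nil !mul1r.
  by rewrite !sumr_const mulrC.
rewrite (tree_sumS _ (fun _ _ : B => 1) t.+1)// (tree_sumS _ b t.+1)//.
have [rt|rt] := eqVneq (r t.+1) t.+1; last first.
  by under eq_bigr do rewrite mulr1; under [in leRHS]eq_bigr do rewrite mulr1.
under [in leRHS]eq_bigr do rewrite expr1n sumr_const.
rewrite -[in leRHS]mulr_suml -/(tree_sum _ _ _ t.+1) mulrA.
apply: (@le_trans _ _ (#|B|%:R * tree_sum x0 b r t.+1 * #|B|%:R)); last first.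
  by apply: ler_pM => //; rewrite mulr_ge0// sumr_ge0// => s _;
     rewrite mulr_ge0// prodr_ge0// => k _; rewrite /tree_weight; case: ifP => // _; exact: sqr_ge0.
rewrite -mulrA ler_wpM2l// /tree_sum mulr_suml ler_sum// => s _.
rewrite ler_wpM2l// mulr_ge0// prodr_ge0// => k _.
by rewrite /tree_weight; case: ifP => // _; exact: sqr_ge0.
Qed.

End TreeBound.

(** * Glued polygons *)

(** Side k of the m-gon goes from position [prev_pos m k] to position k.  *)
Definition prev_pos (m k : nat) : nat := if k is k'.+1 then k' else m.-1.

(** A triple (twisted, (k, l)) stands for the gluing of the sides k and l; both
    are traversed in the same direction unless the gluing is twisted.  *)
Definition glue (m : nat) (q : bool * (nat * nat)) : seq (nat * nat) :=
  let: (twisted, (k, l)) := q in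
  if twisted then [:: (prev_pos m k, l); (k, prev_pos m l)]
  else [:: (prev_pos m k, prev_pos m l); (k, l)].

Definition gluing (m : nat) (Q : seq (bool * (nat * nat))) : seq (nat * nat) :=
  flatten [seq glue m q | q <- Q].

Definition glued (Q : seq (bool * (nat * nat))) : seq nat :=
  flatten [seq [:: q.2.1; q.2.2] | q <- Q].

Section Gluing.
Context {R : realType}.

Section OneAlphabet.
Context {A : finType} (x0 : A) (b : A -> A -> R) (m : nat).

Definition edge (w : seq A) (k : nat) : R := b (nth x0 w (prev_pos m k)) (nth x0 w k).

(** For a symmetric b, the covariance of the Gaussian entries at the sides k and
    l of the word (see [edge_covE]), in a form that exhibits the two ways of
    gluing these sides.  *)
Definition edge_cov (w : seq A) (k l : nat) : R :=
  edge w k * edge w l *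
  \sum_(twisted : bool) (satisfies x0 (glue m (twisted, (k, l))) w)%:R.

(** The contribution of the matchings whose first pairs are those of Q, the sides
    in s being still unmatched.  *)
Definition gluing_sum Q (s : seq nat) : R :=
  \sum_(w <- words A m) (satisfies x0 (gluing m Q) w)%:R *
    (\prod_(q <- Q) (edge w q.2.1 * edge w q.2.2)) * hafnian (edge_cov w) s.

Lemma gluing_sum_cons Q x s : gluing_sum Q (x :: s) =
  \sum_(y <- s) \sum_(twisted : bool)
     gluing_sum ((twisted, (x, y)) :: Q) (rem y s).
Proof.
rewrite /gluing_sum; under [RHS]eq_bigr do rewrite exchange_big/=.
rewrite [RHS]exchange_big/=; apply: eq_bigr => w _.
rewrite hafnian_cons mulr_sumr; apply: eq_bigr => y _.
rewrite /edge_cov mulr_sumr mulr_suml mulr_sumr.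
apply: eq_bigr => twisted _.
have -> : satisfies x0 (gluing m ((twisted, (x, y)) :: Q)) w =
    satisfies x0 (glue m (twisted, (x, y))) w && satisfies x0 (gluing m Q) w.
  exact: all_cat.
by rewrite big_cons -mulnb natrM; ring.
Qed.

End OneAlphabet.

Section TwoAlphabets.
Context {A B : finType} (x0 : A) (y0 : B) (b : A -> A -> R) (m : nat).
Hypothesis m_gt0 : (0 < m)%N.
Hypothesis b_sym : forall x y, b x y = b y x.
Hypothesis b_ge0 : forall x y, 0 <= b x y.
Hypothesis b_le1 : forall x y, b x y <= 1.
Hypothesis b_row : forall x, \sum_(y : A) b x y ^+ 2 <= #|B|%:R.

(** Two glued sides have the same weight, at most 1, and cannot both be in the
    spanning tree: if neither is side 0, the last position of the later one lies
    in the class of one of the two positions of the earlier one.  *)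
Lemma edge_pair_le Q r w q : q \in Q -> satisfies x0 (gluing m Q) w ->
  (forall k, (r k <= k)%N) ->
  (forall e, e \in gluing m Q -> r e.1 = r e.2) ->
  q.2.1 != q.2.2 ->
  edge x0 b m w q.2.1 * edge x0 b m w q.2.2
    <= tree_weight x0 b r w q.2.1 * tree_weight x0 b r w q.2.2.
Proof.
case: q => tw [k l] /= qQ satw r_le rE kl.
have glueQ e : e \in glue m (tw, (k, l)) -> e \in gluing m Q.
  by move=> eq; apply/flattenP; exists (glue m (tw, (k, l))) => //; exact: map_f.
have satq e : e \in glue m (tw, (k, l)) -> nth x0 w e.1 = nth x0 w e.2.
  by move=> /glueQ eQ; apply/eqP; exact: (allP satw).
have edge_eq : edge x0 b m w k = edge x0 b m w l.
  rewrite /edge; case: tw satq {qQ glueQ} => /= satq.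
    rewrite (satq (prev_pos m k, l)) ?inE ?eqxx//.
    by rewrite (satq (k, prev_pos m l)) ?inE ?eqxx ?orbT.
  rewrite (satq (prev_pos m k, prev_pos m l)) ?inE ?eqxx//.
  by rewrite (satq (k, l)) ?inE ?eqxx ?orbT.
have not_both : ~~ [&& (0 < k)%N, r k == k, (0 < l)%N & r l == l].
  apply/negP => /and4P[k0 /eqP rk l0 /eqP rl].
  have rq e : e \in glue m (tw, (k, l)) -> r e.1 = r e.2.
    by move=> /glueQ; exact: rE.
  case: tw rq {qQ glueQ satq} => /= rq.
    have := rq (prev_pos m k, l); rewrite inE eqxx => /(_ isT)/= r1.
    have := rq (k, prev_pos m l); rewrite !inE eqxx orbT => /(_ isT)/= r2.
    have := r_le (prev_pos m k); have := r_le (prev_pos m l).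
    by move: k0 l0 kl r1 r2; case: (k) rk => //= k' ->; case: (l) rl => //= l' ->; lia.
  have := rq (k, l); rewrite !inE eqxx orbT => /(_ isT)/= r1.
  by move/eqP: kl; lia.
have e_ge0 : 0 <= edge x0 b m w l by exact: b_ge0.
have e_le1 : edge x0 b m w l <= 1 by exact: b_le1.
have weightE j : tree_weight x0 b r w j =
    if (0 < j)%N && (r j == j) then edge x0 b m w j ^+ 2 else 1.
  by rewrite /tree_weight /edge; case: j.
rewrite !weightE edge_eq.
case: ifPn => [/andP[k0 rk]|_]; case: ifPn => [/andP[l0 rl]|_].
- by rewrite k0 rk l0 rl in not_both.
- by rewrite mulr1.
- by rewrite mul1r.
- by rewrite mulr1 mulr_ile1.
Qed.

(** A complete matching Q covers each side once, so that the product over its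
    pairs is a product over all the sides, to which the tree bound applies.  *)
Lemma gluing_sum_le_complete Q : perm_eq (glued Q) (iota 0 m) ->
  #|B|%:R * gluing_sum x0 b m Q [::]
    <= #|A|%:R * gluing_sum y0 (fun _ _ => 1) m Q [::].
Proof.
move=> Qm.
have glued_lt q : q \in Q -> (q.2.1 < m)%N && (q.2.2 < m)%N.
  move=> qQ; have lt k : k \in [:: q.2.1; q.2.2] -> (k < m)%N.
    move=> kq; have : k \in glued Q.
      by apply/flattenP; exists [:: q.2.1; q.2.2] => //; exact: (map_f _ qQ).
    by rewrite (perm_mem Qm) mem_iota.
  by rewrite !lt ?inE ?eqxx ?orbT.
have prev_lt k : (k < m)%N -> (prev_pos m k < m)%N by case: k => /=; lia.
have [|r [r_le rr rE rP]] := @least_representative m (gluing m Q).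
  move=> e /flattenP[_ /mapP[[tw [k l]] qQ ->]].
  have /andP[/= km lm] := glued_lt _ qQ.
  by case: tw {qQ} => /=; rewrite !inE => /orP[]/eqP-> /=;
    rewrite ?km ?lm ?prev_lt.
have Q_neq q : q \in Q -> q.2.1 != q.2.2.
  move=> qQ; have : uniq (glued Q) by rewrite (perm_uniq Qm) iota_uniq.
  move: qQ; elim: (Q) => //= p Q' IH; rewrite inE => /orP[/eqP ->|/IH H].
    by case/and3P => /=; rewrite inE negb_or => /andP[].
  by case/and3P => _ _; exact: H.
have -> : gluing_sum y0 (fun _ _ => 1) m Q [::] =
    \sum_(w <- words B m) (respects y0 r m w)%:R.
  apply: eq_bigr => w _; rewrite rP big1 ?mulr1// => q _.
  by rewrite /edge mulr1.
apply: (@le_trans _ _ (#|B|%:R * tree_sum x0 b r m)); last first.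
  by case: m m_gt0 => // m' _; apply: tree_sum_le.
rewrite ler_wpM2l// ler_sum// => w _; rewrite mulr1 rP.
have [resp|_] := boolP (respects x0 r m w); last by rewrite !mul0r.
rewrite !mul1r -(perm_big _ Qm)/= /glued big_flatten/= big_map.
under [leRHS]eq_bigr do rewrite big_cons big_seq1.
rewrite big_seq [leRHS]big_seq; apply: ler_prod => q qQ.
apply/andP; split; first by rewrite mulr_ge0// b_ge0.
by apply: (edge_pair_le qQ) => //; [rewrite rP|exact: Q_neq].
Qed.

Lemma gluing_sum_le Q s : perm_eq (glued Q ++ s) (iota 0 m) ->
  #|B|%:R * gluing_sum x0 b m Q s
    <= #|A|%:R * gluing_sum y0 (fun _ _ => 1) m Q s.
Proof.
have [N] := ubnP (size s); elim: N s Q => // N IH [|x s] Q /= sN Qs.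
  by apply: gluing_sum_le_complete; rewrite cats0 in Qs.
rewrite !gluing_sum_cons !mulr_sumr.
rewrite big_seq [leRHS]big_seq; apply: ler_sum => y ys.
rewrite !mulr_sumr; apply: ler_sum => tw _.
have {}sN : (size s < N)%N by [].
apply: IH; first by rewrite (size_rem ys) (leq_ltn_trans (leq_pred _)).
apply: perm_trans Qs; apply/permP => p.
have /permP/(_ p) := perm_to_rem ys.
rewrite /glued/= !count_cat/= => ->. lia.
Qed.

End TwoAlphabets.
End Gluing.

(** * Traces of powers as sums over cyclic words *)

Lemma sum_indicator (R : pzSemiRingType) (I : finType) (c : I) (F : I -> R) :
  \sum_a (c == a)%:R * F a = F c.
Proof.
rewrite (bigD1 c)//= eqxx mul1r big1 ?addr0// => a.
by rewrite eq_sym => /negbTE ->; rewrite mul0r.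
Qed.

Section TraceOfPower.
Context {R : comNzRingType} {n : nat} (x0 : 'I_n) (M : 'M[R]_n).

Lemma expmx_words t i j : (M ^+ t) i j =
  \sum_(w <- words 'I_n t) (last i w == j)%:R *
    \prod_(k <- iota 0 t) M (nth x0 (i :: w) k) (nth x0 w k).
Proof.
elim: t j => [|t IH] j.
  by rewrite /= big_seq1 big_nil mulr1 /= expr0 mxE.
rewrite exprSr -[_ * _]/(_ *m _) mxE sum_wordsS.
under eq_bigr do rewrite IH mulr_suml.
rewrite exchange_big/=; apply: eq_big_seq => w ww.
have sw := size_words ww.
under eq_bigr do rewrite -mulrA.
rewrite (sum_indicator (last i w)
  (fun a => (\prod_(k <- iota 0 t) M (nth x0 (i :: w) k) (nth x0 w k)) * M a j)).
under [RHS]eq_bigr do rewrite last_rcons eq_sym.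
rewrite (sum_indicator j (fun a => \prod_(k <- iota 0 t.+1)
  M (nth x0 (i :: rcons w a) k) (nth x0 (rcons w a) k))).
rewrite -[in RHS](addn1 t) iotaD big_cat/= big_seq1 add0n.
rewrite -rcons_cons !nth_rcons /= sw ltnSn ltnn eqxx; congr (_ * _).
  apply: eq_big_seq => k; rewrite mem_iota add0n => /andP[_ kt].
  by rewrite -rcons_cons !nth_rcons/= sw kt ?ltnS (ltnW kt).
by rewrite (last_nth x0) sw.
Qed.

Lemma trace_words t : (0 < t)%N -> \tr (M ^+ t) =
  \sum_(w <- words 'I_n t)
    \prod_(k <- iota 0 t) M (nth x0 w (prev_pos t k)) (nth x0 w k).
Proof.
case: t => // t _; rewrite /mxtrace; under eq_bigr do rewrite expmx_words.
rewrite exchange_big; apply: eq_big_seq => w ww.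
have sw := size_words ww.
have lastE i : last i w = nth x0 w t.
  by rewrite (last_nth x0) sw.
under eq_bigr do rewrite lastE.
rewrite (sum_indicator (nth x0 w t) (fun a => \prod_(k <- iota 0 t.+1)
  M (nth x0 (a :: w) k) (nth x0 w k))).
by apply: eq_bigr => -[].
Qed.

End TraceOfPower.

Lemma prod_by_label (R : comNzRingType) (A : Type) (I : finType) (lab : A -> I)
    (F : I -> R) (s : seq A) :
  \prod_(k <- s) F (lab k) = \prod_i F i ^+ count (fun k => lab k == i) s.
Proof.
elim: s => [|a s IH]; first by rewrite big_nil big1.
under [RHS]eq_bigr do rewrite /= exprD.
rewrite big_cons IH big_split/=; congr (_ * _).
rewrite (bigD1 (lab a))//= eqxx [X in _ * X]big1 ?mulr1// => i ia.
by rewrite eq_sym (negbTE ia).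
Qed.

(** * Entries as labelled sides *)

Section Labels.
Context {n : nat}.
Implicit Types p q : 'I_n * 'I_n.

(** The representative in the lower triangle of an unordered pair of indices.  *)
Definition lower p : 'I_n * 'I_n := if (p.2 <= p.1)%N then p else (p.2, p.1).

Lemma lower_le p : ((lower p).2 <= (lower p).1)%N.
Proof. by rewrite /lower; case: ifP => //= /negbT; lia. Qed.

Lemma lower_sym (V : Type) (f : 'I_n -> 'I_n -> V) p :
  (forall i j, f i j = f j i) -> f (lower p).1 (lower p).2 = f p.1 p.2.
Proof. by move=> fC; rewrite /lower; case: ifP. Qed.

Lemma lower_eq p q : (lower p == lower q) = (p == q) || (p == (q.2, q.1)).
Proof.
case: p q => [i j] [k l]; rewrite /lower/=.
case: (leqP j i); case: (leqP l k); rewrite !xpair_eqE -!val_eqE/=; lia.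
Qed.

Context {R : realType} (x0 : 'I_n) (m : nat).

Definition edge_label (w : seq 'I_n) (k : nat) : 'I_n * 'I_n :=
  lower (nth x0 w (prev_pos m k), nth x0 w k).

Definition wigner_variance (b : 'I_n -> 'I_n -> R) p : R :=
  (if p.1 == p.2 then 2 else 1) * b p.1 p.2 ^+ 2.

(** The factor 2 on the diagonal is what makes this hold there: for a constant
    pair the twisted and the untwisted identifications are both satisfied.  *)
Lemma edge_covE (b : 'I_n -> 'I_n -> R) w k l : (forall i j, b i j = b j i) ->
  edge_cov x0 b m w k l =
  if edge_label w k == edge_label w l
  then wigner_variance b (edge_label w k) else 0.
Proof.
move=> bC; rewrite /edge_cov big_bool /edge /edge_label.
set a := nth x0 w (prev_pos m k); set a' := nth x0 w k.
rewrite /satisfies/= !andbT -/a -/a'.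
set e := nth x0 w (prev_pos m l); set e' := nth x0 w l.
rewrite lower_eq /wigner_variance (lower_sym (f := b))//.
rewrite (lower_sym (f := fun i j => i == j)); last by move=> i j; rewrite eq_sym.
rewrite !xpair_eqE /= orbC.
have [/andP[/eqP -> /eqP ->]|diff] := boolP ((a == e) && (a' == e')).
  rewrite orbT (eq_sym e') andbb.
  by have [->|_] := eqVneq e e'; rewrite /= ?mulr1n ?mulr0n; ring.
have [/andP[/eqP ae' /eqP a'e]|_] := boolP ((a == e') && (a' == e)).
  move: diff; rewrite ae' a'e (bC e e') (eq_sym e) andbb => /negbTE ->.
  by rewrite /= ?mulr1n ?mulr0n; ring.
by rewrite addr0 mulr0.
Qed.

End Labels.

(** * Expectations of words *)

Section WordExpectation.
Context {R : realType} {disp : measure_display} {T : measurableType disp}.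
Context {P : probability T R} {n : nat} (x0 : 'I_n) (m : nat).
Context (Z X : 'I_n -> 'I_n -> {RV P >-> R}) (c : 'I_n -> 'I_n -> R).
Hypothesis c_sym : forall i j, c i j = c j i.
Hypothesis Z_sym : forall i j, Z i j = Z j i.
Hypothesis Z_indep : independent_lower Z.
Hypothesis Z_int : forall i j k, P.-integrable setT (fun t => (Z i j t ^+ k)%:E).
Hypothesis XE : forall i j t, X i j t = c i j * Z i j t.

Local Notation D := [set p : 'I_n * 'I_n | (p.2 <= p.1)%N]%SET.

Definition multiplicity (u : seq 'I_n) (p : 'I_n * 'I_n) : nat :=
  count (fun k => edge_label x0 m u k == p) (iota 0 m).

Definition entry_moment (p : 'I_n * 'I_n) (k : nat) : R :=
  fine (\int[P]_t (Z p.1 p.2 t ^+ k)%:E)%E.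

(** Labels outside the lower triangle do not occur.  *)
Lemma prod_lower (G : 'I_n * 'I_n -> nat -> R) u : (forall p, G p 0%N = 1) ->
  \prod_p G p (multiplicity u p) = \prod_(p in D) G p (multiplicity u p).
Proof.
move=> G0; rewrite [RHS]big_mkcond; apply: eq_bigr => p _; rewrite inE.
case: ifPn => // pD; rewrite /multiplicity (_ : count _ _ = 0%N)//.
apply/eqP; rewrite -leqn0 leqNgt -has_count; apply/hasPn => k _.
by apply: contra pD => /eqP <-; exact: lower_le.
Qed.

Let word_term u t : R :=
  \prod_(k <- iota 0 m) X (nth x0 u (prev_pos m k)) (nth x0 u k) t.

Let labelled (u : seq 'I_n) p (x : R) : R := (c p.1 p.2 * x) ^+ multiplicity u p.

Let word_termE u t :
  word_term u t = \prod_(p in D) labelled u p (Z p.1 p.2 t).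
Proof.
rewrite /word_term /labelled.
rewrite -(prod_lower (G := fun p k => (c p.1 p.2 * Z p.1 p.2 t) ^+ k))//.
rewrite /multiplicity -(prod_by_label _ (fun p => c p.1 p.2 * Z p.1 p.2 t)).
apply: eq_bigr => k _.
rewrite /edge_label (lower_sym (f := fun i j => c i j * Z i j t)) ?XE//.
by move=> i j; rewrite c_sym Z_sym.
Qed.

Let measurable_labelled u p : measurable_fun setT (labelled u p).
Proof. by apply: measurable_funX; apply: measurable_funM. Qed.

Let labelled_int u p :
  P.-integrable setT (fun t => (labelled u p (Z p.1 p.2 t))%:E) /\
  (\int[P]_t (labelled u p (Z p.1 p.2 t))%:E =
    (c p.1 p.2 ^+ multiplicity u p * entry_moment p (multiplicity u p))%:E)%E.
Proof.
rewrite /labelled; under eq_fun do rewrite exprMn EFinM.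
split; first exact: integrableZl.
rewrite integralZl// EFinM fineK//.
exact: integrable_fin_num.
Qed.

Lemma integrable_word u : P.-integrable setT (fun t => (word_term u t)%:E).
Proof.
under eq_fun do rewrite word_termE.
apply: (integrable_prod (X := fun p => Z p.1 p.2) Z_indep) => p.
  exact: measurable_labelled.
by have [] := labelled_int u p.
Qed.

Lemma expectation_word u : (\int[P]_t (word_term u t)%:E =
  (\prod_(p in D) (c p.1 p.2 ^+ multiplicity u p
                   * entry_moment p (multiplicity u p)))%:E)%E.
Proof.
under eq_integral do rewrite word_termE.
apply: (expectation_prod_signed (X := fun p => Z p.1 p.2) Z_indep (K := enum {: 'I_n * 'I_n})) => p.
- exact: measurable_labelled.
- by rewrite mem_enum.
- by have [] := labelled_int u p.
- by have [] := labelled_int u p.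
Qed.

Lemma expectation_ntrace : (0 < m)%N ->
  ('E_P[fun t => ntrace (random_mx X t ^+ m)] =
   (n%:R^-1 * \sum_(u <- words 'I_n m) \prod_(p in D)
     (c p.1 p.2 ^+ multiplicity u p * entry_moment p (multiplicity u p)))%:E)%E.
Proof.
move=> m0; rewrite unlock.
transitivity (\int[P]_t (n%:R^-1%:E * \sum_(u <- words 'I_n m) (word_term u t)%:E))%E.
  apply: eq_integral => t _; rewrite /ntrace (trace_words x0)// EFinM -sumEFin.
  congr (_ * _)%E; apply: eq_bigr => u _; congr EFin; apply: eq_bigr => k _.
  by rewrite mxE.
rewrite integralZl//; last first.
  by apply: integrable_sum => // u _; exact: integrable_word.
rewrite integral_sum//; last exact: integrable_word.
by rewrite EFinM -sumEFin; congr (_ * _)%E; apply: eq_bigr => u _;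
  exact: expectation_word.
Qed.

(** Wick's formula for a word in the entries of a symmetric Gaussian matrix.  *)
Lemma hafnian_edge_cov (b : 'I_n -> 'I_n -> R) u : (forall i j, b i j = b j i) ->
  hafnian (edge_cov x0 b m u) (iota 0 m) =
  \prod_(p in D) gauss_moment (wigner_variance b p) (multiplicity u p).
Proof.
move=> bC; rewrite -(prod_lower (G := fun p => gauss_moment (wigner_variance b p)))//.
by rewrite -hafnian_diagonal; apply: eq_hafnian => k l; exact: edge_covE.
Qed.

End WordExpectation.

(** * The comparison *)

(** The comparison of Gaussian traces: the empty matching, with all the sides
    unmatched.  *)
Lemma hafnian_sum_le (R : realType) (A B : finType) (x0 : A) (y0 : B)
    (b : A -> A -> R) (m : nat) : (0 < m)%N ->
  (forall x y, b x y = b y x) -> (forall x y, 0 <= b x y) ->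
  (forall x y, b x y <= 1) ->
  (forall x, \sum_(y : A) b x y ^+ 2 <= #|B|%:R) ->
  #|B|%:R * \sum_(w <- words A m) hafnian (edge_cov x0 b m w) (iota 0 m)
  <= #|A|%:R * \sum_(w <- words B m)
                 hafnian (edge_cov y0 (fun _ _ => 1) m w) (iota 0 m) :> R.
Proof.
move=> m0 bC b0 b1 brow.
have := gluing_sum_le x0 y0 m0 bC b0 b1 brow (perm_refl (glued [::] ++ iota 0 m)).
rewrite /gluing_sum.
by under eq_bigr do rewrite big_nil !mul1r; under [in X in _ <= X]eq_bigr do
  rewrite big_nil !mul1r.
Qed.

Theorem theorem3p3 (R : realType)
    (disp : measure_display) (T : measurableType disp) (P : probability T R)
    (disp' : measure_display) (T' : measurableType disp')
    (P' : probability T' R)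
    (n d : nat) (b : 'I_n -> 'I_n -> R)
    (xi X : 'I_n -> 'I_n -> {RV P >-> R})
    (Y : 'I_d -> 'I_d -> {RV P' >-> R})
    (b_sym : forall i j, b i j = b j i)
    (b_ge0 : forall i j, 0 <= b i j)
    (xi_sym : forall i j, xi i j = xi j i)
    (xi_symdist : forall i j, symmetrically_distributed (xi i j))
    (xi_indep : independent_lower xi)
    (xi_moments : forall i j (p : nat),
       ('E_P[fun w => (xi i j w ^+ (2 * p))%R]
          <= 'E_(gaussian_law (1 : R))[fun g => (g ^+ (2 * p))%R])%E)
    (X_offdiag : forall i j, i != j -> forall w, X i j w = b i j * xi i j w)
    (X_diag : forall i w, X i i w = Num.sqrt 2 * b i i * xi i i w)
    (b_max : sigma_star2 b = 1)
    (b_rows : sigma2 b <= d%:R)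
    (Y_sym : forall i j, Y i j = Y j i)
    (Y_indep : independent_lower Y)
    (Y_offdiag : forall i j : 'I_d, (j < i)%N -> has_law (Y i j) (gaussian_law 1))
    (Y_diag : forall i, has_law (Y i i) (gaussian_law 2)) :
  forall p : nat,
    ('E_P[fun w => ntrace (random_mx X w ^+ (2 * p))%R]
       <= 'E_P'[fun w => ntrace (random_mx Y w ^+ (2 * p))%R])%E.
Proof.
have brow i : \sum_(j < n) b i j ^+ 2 <= d%:R.
  by apply: le_trans b_rows; exact: (le_bigmax _ (fun i => \sum_(j < n) b i j ^+ 2)).
have b2_le1 i j : b i j ^+ 2 <= 1.
  rewrite -b_max; apply: (le_trans (le_bigmax 0 (fun j => b i j ^+ 2) j)).
  exact: (le_bigmax 0 (fun i => \big[Num.max/0]_(j < n) b i j ^+ 2)).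
have b_le1 i j : b i j <= 1 by rewrite -(expr_le1 (n := 2)).
have n_gt0 : (0 < n)%N.
  rewrite lt0n; apply/eqP => n0; subst n.
  by move: b_max; rewrite /sigma_star2 big_ord0 => /esym/eqP; rewrite oner_eq0.
(* With d = 0 the row sums, hence all the b i j, would vanish. *)
have d_gt0 : (0 < d)%N.
  rewrite lt0n; apply/eqP => d0; subst d.
  have : sigma_star2 b <= 0.
    apply: bigmax_le => // i _; apply: bigmax_le => // j _.
    by apply: le_trans (brow i); rewrite (bigD1 j)//= lerDl sumr_ge0// => k _; exact: sqr_ge0.
  by rewrite b_max ler10.
pose x0 := Ordinal n_gt0; pose y0 := Ordinal d_gt0.
move=> [|p'].
  have ntrace1 (k : nat) (M : 'M[R]_k) : (0 < k)%N -> ntrace (M ^+ (2 * 0)) = 1.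
    by move=> k0; rewrite muln0 expr0 /ntrace mxtrace1 mulVf// pnatr_eq0 -lt0n.
  have -> : (fun w => ntrace (random_mx X w ^+ (2 * 0))) = cst 1.
    by apply/funext => w; exact: ntrace1.
  have -> : (fun w => ntrace (random_mx Y w ^+ (2 * 0))) = cst 1.
    by apply/funext => w; exact: ntrace1.
  by rewrite !expectation_cst.
pose m := (2 * p'.+1)%N; have m0 : (0 < m)%N by [].
rewrite -/m.
(* The moments of xi, hence those of X, are at most Gaussian. *)
have even_xi i j k : (\int[P]_w (xi i j w ^+ k.*2)%:E
    <= (gauss_moment 1 k.*2)%:E)%E.
  by have := xi_moments i j k; rewrite unlock mul2n gaussian_law_even_moment.
have even_xi_fin i j k : (\int[P]_w (xi i j w ^+ k.*2)%:E < +oo)%E.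
  exact: le_lt_trans (even_xi i j k) (ltry _).
have xi_int i j k := integrable_RV_pow (even_xi_fin i j) k.
pose c i j := if i == j then Num.sqrt 2 * b i j else b i j.
have c_sym i j : c i j = c j i by rewrite /c eq_sym b_sym.
have XE i j w : X i j w = c i j * xi i j w.
  rewrite /c; have [->|ij] := eqVneq i j; first exact: X_diag.
  exact: X_offdiag.
have varE q : wigner_variance b q = c q.1 q.2 ^+ 2 * 1.
  rewrite /wigner_variance /c mulr1; case: eqP => // _; last by rewrite mul1r.
  by rewrite exprMn sqr_sqrtr.
have entry_le q k :
    0 <= c q.1 q.2 ^+ k * entry_moment xi q k <= gauss_moment (wigner_variance b q) k.
  rewrite varE gauss_momentZ /entry_moment.
  have [ok|ek] := boolP (odd k).
    by rewrite odd_moment_sym// gauss_moment_odd// !mulr0 lexx.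
  have ck0 : 0 <= c q.1 q.2 ^+ k by rewrite exprn_even_ge0.
  rewrite mulr_ge0 ?ler_wpM2l//=.
    rewrite -lee_fin fineK; last exact: integrable_fin_num (xi_int _ _ _).
    by rewrite -(even_halfK ek).
  by apply: fine_ge0; apply: integral_ge0 => w _; rewrite lee_fin exprn_even_ge0.
rewrite (expectation_ntrace x0 c_sym xi_sym xi_indep xi_int XE m0).
(* The moments of Y are those of the matrix with all b equal to 1. *)
have varE1 q : wigner_variance (fun _ _ : 'I_d => 1 : R) q =
    if q.1 == q.2 then 2 else 1 by rewrite /wigner_variance expr1n mulr1.
have Y_moment (q : 'I_d * 'I_d) k : (q.2 <= q.1)%N ->
    P'.-integrable setT (fun w => (Y q.1 q.2 w ^+ k)%:E) /\
    (\int[P']_w (Y q.1 q.2 w ^+ k)%:E =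
      (gauss_moment (wigner_variance (fun _ _ => 1) q) k)%:E)%E.
  rewrite leq_eqVlt varE1 => /orP[/eqP/val_inj|] q12.
    by rewrite q12 eqxx; apply: has_gaussian_law_moment.
  rewrite (gtn_eqF q12 : (q.1 == q.2) = false).
  by apply: has_gaussian_law_moment => //; exact: Y_offdiag.
have Y_int i j k : P'.-integrable setT (fun w => (Y i j w ^+ k)%:E).
  have [ji|ij] := leqP j i; first by have [] := Y_moment (i, j) k ji.
  by rewrite Y_sym; have [] := Y_moment (j, i) k (ltnW ij).
rewrite (@expectation_ntrace _ _ _ _ _ y0 m Y Y (fun _ _ => 1))//; last first.
  by move=> i j w; rewrite mul1r.
rewrite lee_fin.
set D := [set _ | _]%SET; set D' := [set _ | _]%SET.
have <- : \sum_(w <- words 'I_d m)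
    hafnian (edge_cov y0 (fun _ _ => 1) m w) (iota 0 m) =
  \sum_(u <- words 'I_d m) \prod_(q in D')
    (1 ^+ multiplicity y0 m u q * entry_moment Y q (multiplicity y0 m u q)) :> R.
  apply: eq_bigr => u _; rewrite hafnian_edge_cov//.
  apply: eq_bigr => q; rewrite inE => qD.
  by rewrite expr1n mul1r /entry_moment (Y_moment q _ qD).2.
apply: (@le_trans _ _ (n%:R^-1 * \sum_(w <- words 'I_n m)
    hafnian (edge_cov x0 b m w) (iota 0 m))).
  rewrite ler_wpM2l ?invr_ge0// ler_sum// => u _; rewrite hafnian_edge_cov//.
  by apply: ler_prod => q _; exact: entry_le.
have := @hafnian_sum_le R 'I_n 'I_d x0 y0 b m m0 b_sym b_ge0 b_le1.
rewrite !card_ord => /(_ brow) main.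
by rewrite ler_pdivrMl ?ltr0n// mulrCA ler_pdivlMl ?ltr0n.
Qed.
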